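(* Let $\mathbb{K}$ be a field and let $\mathcal{G}$ be a second-countable ample groupoid such that $\mathcal{G}^{(0)}$ is Hausdorff, $\mathcal{G}$ is effective, and $\operatorname{supp}(f)$ has nonempty interior in $\mathcal{G}$ for every nonzero $f\in A_{\mathbb{K}}(\mathcal{G})$. Suppose $A$ is a $\mathbb{K}$-algebra and $\pi:A_{\mathbb{K}}(\mathcal{G})\to A$ is a ring homomorphism with nonzero kernel. Then there exists a nonempty compact open set $L\subseteq\mathcal{G}^{(0)}$ such that $1_L\in\ker(\pi)$.
   Context: All groupoids are topological groupoids $\mathcal{G}$ with unit space $\mathcal{G}^{(0)}$ and range and source maps $r,s$; they are locally compact but not necessarily Hausdorff, and ''compact'' does not presuppose Hausdorff. An open bisection is an open set $B\subseteq\mathcal{G}$ such that $r$ and $s$ each restrict to a homeomorphism of $B$ onto an open subset of $\mathcal{G}^{(0)}$. $\mathcal{G}$ is étale if its topology has a basis of open bisections, and ample if its topology has a basis of compact open bisections. The isotropy bundle is $\operatorname{Iso}(\mathcal{G})=\{\gamma\in\mathcal{G}: r(\gamma)=s(\gamma)\}$; $\mathcal{G}$ is effective if the interior of $\operatorname{Iso}(\mathcal{G})$ equals $\mathcal{G}^{(0)}$. For an ample groupoid with Hausdorff unit space, the Steinberg algebra $A_{\mathbb{K}}(\mathcal{G})$ is the $\mathbb{K}$-linear span of the characteristic functions $1_B:\mathcal{G}\to\mathbb{K}$ of compact open bisections $B$, with pointwise addition and scalar multiplication and convolution product $f*g(\gamma)=\sum_{r(\eta)=r(\gamma)}f(\eta)g(\eta^{-1}\gamma)$.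 For a function $f$ on $\mathcal{G}$, $\operatorname{supp}(f)=\{\gamma: f(\gamma)\neq 0\}$ (no closure is taken). *)

(* Defs.v *)
From HB Require Import structures.
From mathcomp Require Import all_boot all_order all_algebra.
From mathcomp Require Import mathcomp_extra boolp classical_sets functions.
From mathcomp Require Import cardinality fsbigop topology numfun.

Set Implicit Arguments.
Unset Strict Implicit.
Unset Printing Implicit Defensive.

Import GRing.Theory.

Local Open Scope classical_set_scope.
Local Open Scope ring_scope.

(* A groupoid is presented by its arrows: a unit is identified with its
   identity arrow, so range and source take values in the groupoid itself.
   The product [gmul x y] is a total function, whose value is unconstrained
   (and meaningless) unless [sg x = rg y]. *)
HB.mixin Record isGroupoid (G : Type) := {
  rg : G -> G;
  sg : G -> G;
  gmul : G -> G -> G;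
  ginv : G -> G;
  rg_rg : forall x, rg (rg x) = rg x;
  sg_rg : forall x, sg (rg x) = rg x;
  rg_sg : forall x, rg (sg x) = sg x;
  sg_sg : forall x, sg (sg x) = sg x;
  rg_mul : forall x y, sg x = rg y -> rg (gmul x y) = rg x;
  sg_mul : forall x y, sg x = rg y -> sg (gmul x y) = sg y;
  gmulA : forall x y z, sg x = rg y -> sg y = rg z ->
    gmul x (gmul y z) = gmul (gmul x y) z;
  rg_mul1 : forall x, gmul (rg x) x = x;
  sg_mul1 : forall x, gmul x (sg x) = x;
  rg_inv : forall x, rg (ginv x) = sg x;
  sg_inv : forall x, sg (ginv x) = rg x;
  gmulV : forall x, gmul x (ginv x) = rg x;
  gmulVl : forall x, gmul (ginv x) x = sg x
}.

#[short(type="groupoidType")]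
HB.structure Definition Groupoid := {G of isGroupoid G}.

HB.mixin Record Groupoid_isTopGroupoid G of Groupoid G & Topological G := {
  gmul_continuous :
    {within [set p : G * G | sg p.1 = rg p.2],
      continuous (fun p : G * G => gmul p.1 p.2)};
  ginv_continuous : continuous (ginv : G -> G)
}.

#[short(type="topGroupoidType")]
HB.structure Definition TopGroupoid :=
  {G of Groupoid_isTopGroupoid G & Groupoid G & Topological G}.

Definition units (G : groupoidType) : set G := range (@rg G).
Arguments units : clear implicits.

Definition isotropy (G : groupoidType) : set G := [set x | rg x = sg x].
Arguments isotropy : clear implicits.

(* [f] restricts to a homeomorphism of [B] onto an open subset of [U],
   where [U] carries the subspace topology. *)
Definition homeo_onto_open (T : topologicalType) (f : T -> T) (B U : set T) :=
  [/\ f @` B `<=` U, open (f @` B : set (subspace U)),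
      {within B, continuous f} &
      exists g : T -> T, {in B, cancel f g} /\ {within f @` B, continuous g}].

Definition open_bisection (G : topGroupoidType) (B : set G) :=
  [/\ open B, homeo_onto_open (@rg G) B (units G)
    & homeo_onto_open (@sg G) B (units G)].

Definition compact_open_bisection (G : topGroupoidType) (B : set G) :=
  compact B /\ open_bisection B.

(* Ample groupoids are locally compact, see [ample_locally_compact]. *)
Definition ample (G : topGroupoidType) :=
  exists2 B : set (set G), B `<=` @compact_open_bisection G & basis B.
Arguments ample : clear implicits.

Definition effective (G : topGroupoidType) := (isotropy G)° = units G.
Arguments effective : clear implicits.

(* [set_type] carries the genuine subspace topology; [subspace] would isolate
   the points of the complement. *)
Definition hausdorff_units (G : topGroupoidType) :=
  hausdorff_space (set_type (units G)).
Arguments hausdorff_units : clear implicits.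

(* Associative K-algebras, not assumed to have a unit: the Steinberg algebra is
   unital only when the unit space is compact, so MathComp's unital [algType]
   does not apply. *)
HB.mixin Record Lmodule_isNUAlgebra (K : fieldType) A of GRing.Lmodule K A := {
  numul : A -> A -> A;
  numulA : associative numul;
  numulDl : left_distributive numul +%R;
  numulDr : right_distributive numul +%R;
  numulZl : forall (a : K) x y, numul (a *: x) y = a *: numul x y;
  numulZr : forall (a : K) x y, numul x (a *: y) = a *: numul x y
}.

#[short(type="nuAlgType")]
HB.structure Definition NUAlgebra (K : fieldType) :=
  {A of Lmodule_isNUAlgebra K A & GRing.Lmodule K A}.

Section steinberg_functions.
Context {K : fieldType} {G : topGroupoidType}.
Implicit Types f g : G -> K.

(* The sum has at most finitely many nonzero terms when [f] is in the span of
   characteristic functions of bisections ([\sum_(_ \in _)] is 0 otherwise). *)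
Definition convolution f g : G -> K :=
  fun x => \sum_(y \in [set y : G | rg y = rg x]) f y * g (gmul (ginv y) x).

Definition steinberg_span : set (G -> K) :=
  [set f | exists (n : nat) (c : 'I_n -> K) (B : 'I_n -> set G),
    (forall i, compact_open_bisection (B i)) /\
    f = fun x => \sum_(i < n) c i * \1_(B i) x].

Definition supp f : set G := [set x | f x != 0].

End steinberg_functions.

Section topological_groupoid_theory.
Context {G : topGroupoidType}.
Implicit Types (B C : set G) (x y : G).

Lemma units_rg x : units G (rg x).
Proof. by exists x. Qed.

Lemma units_sg x : units G (sg x).
Proof. by exists (sg x) => //; rewrite rg_sg. Qed.

Lemma rg_unit x : units G x -> rg x = x.
Proof. by move=> [y _ <-]; rewrite rg_rg. Qed.

Lemma sg_unit x : units G x -> sg x = x.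
Proof. by move=> [y _ <-]; rewrite sg_rg. Qed.

Lemma cvg_gmul (T : Type) (F : set_system T) (f g : T -> G) x y :
  Filter F -> sg x = rg y -> (\forall t \near F, sg (f t) = rg (g t)) ->
  f @ F --> x -> g @ F --> y -> (fun t => gmul (f t) (g t)) @ F --> gmul x y.
Proof.
move=> FF xy fg fx gy.
have /subspace_continuousP /(_ (x, y) xy) := @gmul_continuous G.
apply: cvg_trans => U UV.
have : \forall t \near F, [set p : G * G | sg p.1 = rg p.2 ->
    U (gmul p.1 p.2)] (f t, g t).
  have : (fun t => (f t, g t)) @ F --> (x, y) by exact: cvg_pair.
  by apply; exact: UV.
by apply: filterS2 fg => t st /(_ st).
Qed.

Lemma rg_continuous : continuous (@rg G).
Proof.
move=> x.
have -> : @rg G = (fun y => gmul y (ginv y)) by apply/funext => y; rewrite gmulV.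
apply: cvg_gmul; rewrite ?rg_inv//; first by near=> t; rewrite rg_inv.
exact: ginv_continuous.
Unshelve. all: by end_near. Qed.

Lemma sg_continuous : continuous (@sg G).
Proof.
move=> x.
have -> : @sg G = (fun y => gmul (ginv y) y) by apply/funext => y; rewrite gmulVl.
apply: cvg_gmul; rewrite ?sg_inv//; first by near=> t; rewrite sg_inv.
exact: ginv_continuous.
Unshelve. all: by end_near. Qed.

Lemma gmulKV x y : rg x = rg y -> gmul x (gmul (ginv x) y) = y.
Proof.
by move=> xy; rewrite gmulA ?rg_inv ?sg_inv// gmulV xy rg_mul1.
Qed.

Lemma gmulK x y : sg x = rg y -> gmul (ginv x) (gmul x y) = y.
Proof.
by move=> xy; rewrite gmulA ?rg_inv ?sg_inv// gmulVl xy rg_mul1.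
Qed.

Hypothesis ampG : ample G.

Lemma ample_nbhs x (A : set G) : nbhs x A ->
  exists B, [/\ compact_open_bisection B, B x & B `<=` A].
Proof.
case: ampG => D Dcob [_ /(_ x)] /(_ A) + xA => /(_ xA)[B [DB Bx] BA].
by exists B; split => //; exact: Dcob.
Qed.

Lemma open_bisection_inj_rg B x y : open_bisection B -> B x -> B y ->
  rg x = rg y -> x = y.
Proof.
move=> [_ [_ _ _ [h [hK _]]] _] Bx By xy.
by rewrite -(hK x) ?inE// xy hK// inE.
Qed.

Lemma open_bisection_inj_sg B x y : open_bisection B -> B x -> B y ->
  sg x = sg y -> x = y.
Proof.
move=> [_ _ [_ _ _ [h [hK _]]]] Bx By xy.
by rewrite -(hK x) ?inE// xy hK// inE.
Qed.

Lemma open_units : open (units G).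
Proof.
rewrite openE => x Gx.
have [B [[_ bisB] Bx _]] := ample_nbhs (@filterT _ (nbhs x) _).
have [oB _ _] := bisB.
have nB : nbhs x B by exact: open_nbhs_nbhs.
have nrB : nbhs x (rg @^-1` B).
  by apply: rg_continuous; rewrite rg_unit//; exact: nB.
rewrite /interior; apply: filterS2 nB nrB => y By /= Bry.
rewrite (@open_bisection_inj_rg B y (rg y)) ?rg_rg//.
exact: units_rg.
Qed.

Lemma open_open_units (A : set G) : A `<=` units G ->
  open (A : set (subspace (units G))) -> open A.
Proof.
move=> AG /open_subspaceP[V oV]; rewrite (setIidl AG) => <-.
by apply: openI => //; exact: open_units.
Qed.

Lemma homeo_openP (f : G -> G) B : homeo_onto_open f B (units G) ->
  open (f @` B) /\
  exists2 h, {in B, cancel f h} & forall y, (f @` B) y -> {for y, continuous h}.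
Proof.
move=> [fBG /(open_open_units fBG) ofB _ [h [hK]]].
rewrite continuous_open_subspace// => hc; split => //.
by exists h => // y fBy; apply: hc; rewrite inE.
Qed.

Lemma homeo_openI (f : G -> G) B : continuous f -> f @` B `<=` units G ->
  open (f @` B) ->
  (exists2 h, {in B, cancel f h} &
    forall y, (f @` B) y -> {for y, continuous h}) ->
  homeo_onto_open f B (units G).
Proof.
move=> fc fBG ofB [h hK hc]; split => //.
- by apply/open_subspaceP; exists (f @` B).
- exact: continuous_subspaceT.
- exists h; split => //; rewrite continuous_open_subspace// => y.
  by rewrite inE; exact: hc.
Qed.

Lemma ample_locally_compact x (A : set G) : nbhs x A ->
  exists2 C, nbhs x C & compact C /\ C `<=` A.
Proof.
move=> /ample_nbhs[B [[cB [oB _ _]] Bx BA]].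
by exists B => //; exact: open_nbhs_nbhs.
Qed.

Definition setgmul B C : set G :=
  [set z | exists x y, [/\ B x, C y, sg x = rg y & gmul x y = z]].

Lemma open_local_homeo (f h : G -> G) (B W : set G) : open W ->
  {in B, cancel f h} -> open (f @` B) ->
  (forall y, (f @` B) y -> {for y, continuous h}) -> open (f @` (B `&` W)).
Proof.
move=> oW hK ofB hc.
rewrite openE => _ [x [Bx Wx] <-].
have fBx : (f @` B) (f x) by exists x.
have nfB : nbhs (f x) (f @` B) by exact: open_nbhs_nbhs.
have nW : nbhs (f x) (h @^-1` W).
  apply: (hc _ fBx); rewrite hK ?inE//.
  exact: open_nbhs_nbhs.
rewrite /interior; apply: filterS2 nfB nW => _ [y By <-] /=.
by rewrite hK ?inE// => Wy; exists y.
Qed.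

Hypothesis hausG : hausdorff_units G.

Lemma hausdorff_unitsP x y : units G x -> units G y ->
  cluster (nbhs x) y -> x = y.
Proof.
move=> Gx Gy xy.
suff /(congr1 val) : (exist _ x (mem_set Gx) : set_type (units G)) =
       exist _ y (mem_set Gy) by [].
apply: hausG => A B [/= _ [[U oU <-] /= Ux UA]] [/= _ [[V oV <-] /= Vy VB]].
have [z [[Uz Vz] Gz]] : U `&` V `&` units G !=set0.
  rewrite setIAC; apply: xy; apply: open_nbhs_nbhs; split => //.
  by apply: openI => //; exact: open_units.
by exists (exist _ z (mem_set Gz)); split; [exact: UA|exact: VB].
Qed.

Lemma compact_unitsI (A B : set G) : A `<=` units G -> B `<=` units G ->
  compact A -> compact B -> compact (A `&` B).
Proof.
move=> AG BG cA cB F FF FAB.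
have [FA FB] : F A /\ F B by split; apply: filterS FAB => ? [].
have [p [Ap]] := cA F FF FA.
rewrite cluster_cvgE => -[F' FF' [F'p FF'F]].
have [q [Bq F'q]] := cB F' FF' (FF'F _ FB).
have pq : p = q.
  apply: hausdorff_unitsP; [exact: AG|exact: BG|].
  exact: (cvg_cluster F'p F'q).
exists p; split; first by split => //; rewrite pq.
rewrite -cluster_cvgE pq => U V FU qV; apply: F'q qV; exact: FF'F.
Qed.

Lemma compact_open_bisection_mul B C : compact_open_bisection B ->
  compact_open_bisection C -> compact_open_bisection (setgmul B C).
Proof.
move=> [cB bB] [cC bC].
have [oB rB sB] := bB; have [oC rC sC] := bC.
have [orB [rhB rhBK rhBc]] := homeo_openP rB.
have [osB [shB shBK shBc]] := homeo_openP sB.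
have [orC [rhC rhCK rhCc]] := homeo_openP rC.
have [osC [shC shCK shCc]] := homeo_openP sC.
split; last split.
- pose D := sg @` B `&` rg @` C.
  have cD : compact D.
    apply: compact_unitsI.
    + by move=> _ [x _ <-]; exact: units_sg.
    + by move=> _ [x _ <-]; exact: units_rg.
    + by apply: continuous_compact cB; apply: continuous_subspaceT; exact: sg_continuous.
    + by apply: continuous_compact cC; apply: continuous_subspaceT; exact: rg_continuous.
  have -> : setgmul B C = (fun u => gmul (shB u) (rhC u)) @` D.
    apply/seteqP; split => [_ [x [y [Bx Cy xy <-]]]|_ [u [[x Bx xu] [y Cy yu]] <-]].
      exists (sg x); first by split; [exists x|exists y].
      by rewrite shBK ?inE// xy rhCK ?inE.
    exists x, y; split => //; first by rewrite xu yu.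
    by rewrite -xu shBK ?inE// xu -yu rhCK ?inE.
  apply: continuous_compact cD.
  rewrite continuous_open_subspace; last exact: openI.
  move=> u; rewrite inE => -[Bu Cu]; apply: cvg_gmul.
  + case: Bu Cu => x Bx <- [y Cy yx].
    by rewrite shBK ?inE// -yx rhCK ?inE.
  + have : nbhs u (sg @` B `&` rg @` C) by apply: open_nbhs_nbhs; split => //; exact: openI.
    apply: filterS => _ [[x Bx <-] [y Cy yx]].
    by rewrite shBK ?inE// -yx rhCK ?inE.
  + exact: shBc.
  + exact: rhCc.
- rewrite openE => _ [x [y [Bx Cy xy <-]]].
  set z := gmul x y.
  have rz : rg z = rg x by rewrite rg_mul.
  have rBz : (rg @` B) (rg z) by rewrite rz; exists x.
  have hz : rhB (rg z) = x by rewrite rz rhBK ?inE.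
  have nrB : nbhs z (rg @^-1` (rg @` B)).
    by apply: rg_continuous; exact: open_nbhs_nbhs.
  have rhBcz : {for z, continuous (rhB \o rg)}.
    by apply: continuous_comp; [exact: rg_continuous|exact: rhBc].
  have nC : nbhs z ((fun w => gmul (ginv (rhB (rg w))) w) @^-1` C).
    suff : (fun w => gmul (ginv (rhB (rg w))) w) @ z --> gmul (ginv x) z.
      by apply; rewrite gmulK//; exact: open_nbhs_nbhs.
    apply: cvg_gmul; rewrite ?sg_inv//.
    + apply: filterS nrB => w /= [b Bb bw].
      by rewrite sg_inv -bw rhBK ?inE.
    + rewrite -[in X in _ --> X]hz.
      apply: (@continuous_comp _ _ _ (rhB \o rg) ginv); first exact: rhBcz.
      exact: ginv_continuous.
  rewrite /interior; apply: filterS2 nrB nC => w /= [b Bb bw].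
  rewrite -bw rhBK ?inE// => Cbw.
  exists b, (gmul (ginv b) w); split => //.
    by rewrite rg_mul ?rg_inv ?sg_inv.
  by rewrite gmulKV.
- have E : rg @` setgmul B C = rg @` (B `&` sg @^-1` (rg @` C)).
    apply/seteqP; split => [_ [_ [x [y [Bx Cy xy <-]]] <-]|_ [x [Bx [y Cy yx]] <-]].
      by exists x; [split => //; exists y|rewrite rg_mul].
    by exists (gmul x y); [exists x, y|rewrite rg_mul].
  apply: homeo_openI.
  + exact: rg_continuous.
  + by move=> _ [x _ <-]; exact: units_rg.
  + rewrite E; apply: open_local_homeo rhBK orB rhBc.
    by apply: open_comp orC => ? _; exact: sg_continuous.
  + exists (fun u => gmul (rhB u) (rhC (sg (rhB u)))).
      move=> _ /set_mem[x [y [Bx Cy xy <-]]].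
      by rewrite rg_mul// rhBK ?inE// xy rhCK ?inE.
    rewrite E => _ [x [Bx [y Cy yx]] <-].
    have rBx : (rg @` B) (rg x) by exists x.
    apply: cvg_gmul.
    * by rewrite rhBK ?inE// -yx rhCK ?inE.
    * have : nbhs (rg x) (rg @` (B `&` sg @^-1` (rg @` C))).
        apply: open_nbhs_nbhs; split; last by exists x => //; split=> //; exists y.
        apply: open_local_homeo rhBK orB rhBc.
        by apply: open_comp orC => ? _; exact: sg_continuous.
      apply: filterS => _ [b [Bb [c Cc cb]] <-].
      by rewrite rhBK ?inE// -cb rhCK ?inE.
    * exact: rhBc.
    * apply: (@continuous_comp _ _ _ (sg \o rhB) rhC).
        by apply: continuous_comp; [exact: rhBc|exact: sg_continuous].
      by apply: rhCc; exists y; rewrite //= rhBK ?inE.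
- have E : sg @` setgmul B C = sg @` (C `&` rg @^-1` (sg @` B)).
    apply/seteqP; split => [_ [_ [x [y [Bx Cy xy <-]]] <-]|_ [y [Cy [x Bx yx]] <-]].
      by exists y; [split => //; exists x|rewrite sg_mul].
    by exists (gmul x y); [exists x, y|rewrite sg_mul].
  apply: homeo_openI.
  + exact: sg_continuous.
  + by move=> _ [x _ <-]; exact: units_sg.
  + rewrite E; apply: open_local_homeo shCK osC shCc.
    by apply: open_comp osB => ? _; exact: rg_continuous.
  + exists (fun u => gmul (shB (rg (shC u))) (shC u)).
      move=> _ /set_mem[x [y [Bx Cy xy <-]]].
      by rewrite sg_mul// shCK ?inE// -xy shBK ?inE.
    rewrite E => _ [y [Cy [x Bx yx]] <-].
    have sCy : (sg @` C) (sg y) by exists y.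
    apply: cvg_gmul.
    * by rewrite shCK ?inE// -yx shBK ?inE.
    * have : nbhs (sg y) (sg @` (C `&` rg @^-1` (sg @` B))).
        apply: open_nbhs_nbhs; split; last by exists y => //; split=> //; exists x.
        apply: open_local_homeo shCK osC shCc.
        by apply: open_comp osB => ? _; exact: rg_continuous.
      apply: filterS => _ [c [Cc [b Bb cb]] <-].
      by rewrite shCK ?inE// -cb shBK ?inE.
    * apply: (@continuous_comp _ _ _ (rg \o shC) shB).
        by apply: continuous_comp; [exact: shCc|exact: rg_continuous].
      by apply: shBc; exists x; rewrite //= shCK ?inE.
    * exact: shCc.
Qed.

End topological_groupoid_theory.

Section steinberg_functions_theory.
Context {K : fieldType} {G : topGroupoidType}.
Implicit Types (f g h : G -> K) (B C : set G).
Let span : set (G -> K) := steinberg_span.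
Let scale (a : K) f : G -> K := fun x => a * f x.

Lemma steinberg_span0 : span 0.
Proof.
exists 0, (fun=> 0), (fun=> set0); split; first by case.
by apply/funext => x; rewrite big_ord0.
Qed.

Lemma steinberg_spanD1 (c : K) B f : compact_open_bisection B -> span f ->
  span (scale c \1_B + f).
Proof.
move=> cobB [n [d [C [cobC ->]]]].
exists n.+1, (oapp d c \o unlift ord0), (oapp C B \o unlift ord0); split.
  by move=> i /=; case: unliftP => [j _|_] /=.
apply/funext => x; rewrite big_ord_recl /= unlift_none; congr (_ + _).
by apply: eq_bigr => i _; rewrite liftK.
Qed.

Lemma steinberg_span_ind (P : (G -> K) -> Prop) : P 0 ->
  (forall (c : K) B f, compact_open_bisection B -> span f -> P f ->
    P (scale c \1_B + f)) ->
  forall f, span f -> P f.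
Proof.
move=> P0 PD f [n [d [C [cobC ->]]]].
suff [] : span (fun x => \sum_(i < n) d i * \1_(C i) x) /\
  P (fun x => \sum_(i < n) d i * \1_(C i) x) by [].
elim: n d C cobC => [d C _|n IH d C cobC].
  under eq_fun do rewrite big_ord0.
  by split; [exact: steinberg_span0|exact: P0].
under eq_fun do rewrite big_ord_recl.
have [sf Pf] := IH (d \o lift ord0) (C \o lift ord0) (fun i => cobC _).
by split; [exact: steinberg_spanD1|exact: PD].
Qed.

Lemma steinberg_spanD f g : span f -> span g -> span (f + g).
Proof.
move=> sf sg; elim/steinberg_span_ind: f / sf => [|c B f cobB sf IH].
  by rewrite add0r.
by rewrite -addrA; exact: steinberg_spanD1.
Qed.

Lemma steinberg_spanZ (a : K) f : span f -> span (scale a f).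
Proof.
elim/steinberg_span_ind => [|c B {}f cobB sf IH].
  suff -> : scale a 0 = 0 by exact: steinberg_span0.
  by apply/funext => x; rewrite /scale mulr0.
suff -> : scale a (scale c \1_B + f) = scale (a * c) \1_B + scale a f.
  exact: steinberg_spanD1.
by apply/funext => x; rewrite /scale fctE mulrDr mulrA.
Qed.

Lemma steinberg_span_indic B : compact_open_bisection B ->
  span \1_B.
Proof.
move=> /(steinberg_spanD1 1)/(_ steinberg_span0).
suff -> : scale 1 \1_B + 0 = \1_B :> (G -> K) by [].
by apply/funext => x; rewrite /scale fctE mul1r addr0.
Qed.

Definition fiber_finite f :=
  forall u, finite_set [set y : G | rg y = u /\ f y != 0].

Lemma steinberg_span_finite f : span f -> fiber_finite f.
Proof.
elim/steinberg_span_ind => [|c B {}f cobB sf IH] u.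
  by apply: sub_finite_set (@finite_set0 G) => y [_ /eqP[]].
have [[z Bz zu]|nB] := pselect (exists2 z, B z & rg z = u).
  apply: (@sub_finite_set _ _ ([set z] `|` [set y | rg y = u /\ f y != 0])).
    move=> y [yu fy]; have [By|nBy] := pselect (B y).
      by left; apply: (open_bisection_inj_rg cobB.2) => //; rewrite yu.
    right; split => //; apply: contra fy => /eqP fy.
    by rewrite fctE /scale indicE memNset// fy mulr0 addr0.
  by rewrite finite_setU.
apply: sub_finite_set (IH u) => y [yu fy]; split => //.
apply: contra fy => /eqP fy.
rewrite fctE /scale indicE memNset ?fy ?mulr0 ?addr0// => By.
by apply: nB; exists y.
Qed.

Lemma convolutionE f g x (P : set G) : finite_set P ->
    P `<=` [set y | rg y = rg x] ->
    [set y | rg y = rg x /\ f y != 0] `<=` P ->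
  convolution f g x = \sum_(y \in P) f y * g (gmul (ginv y) x).
Proof.
move=> finP Px fP; apply/esym/fsbig_widen => // y [/= yx nPy].
have [->|fy] := eqVneq (f y) 0; first by rewrite mul0r.
by exfalso; apply: nPy; exact: fP.
Qed.

Lemma convolutionDl f f' g : fiber_finite f -> fiber_finite f' ->
  convolution (f + f') g = convolution f g + convolution f' g.
Proof.
move=> ff ff'; apply/funext => x.
rewrite -[RHS]/(convolution f g x + convolution f' g x).
pose P := [set y | rg y = rg x /\ f y != 0] `|`
          [set y | rg y = rg x /\ f' y != 0].
have finP : finite_set P by rewrite finite_setU.
have Px : P `<=` [set y | rg y = rg x] by move=> y [[]|[]].
rewrite !(@convolutionE _ _ _ P)//.
- by rewrite -(@fsbig_split _ _ _ +%R)//; apply: eq_fsbigr => y _; rewrite mulrDl.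
- by move=> y; right.
- by move=> y; left.
- move=> y [/= yx]; rewrite fctE.
  have [fy|fy _] := eqVneq (f y) 0; last by left.
  by rewrite fy add0r => f'y; right.
Qed.

Lemma convolutionDr f g g' : fiber_finite f ->
  convolution f (g + g') = convolution f g + convolution f g'.
Proof.
move=> ff; apply/funext => x.
rewrite -[RHS]/(convolution f g x + convolution f g' x).
pose P := [set y | rg y = rg x /\ f y != 0].
have finP : finite_set P by exact: ff.
have Px : P `<=` [set y | rg y = rg x] by move=> y [].
rewrite !(@convolutionE _ _ _ P)// -(@fsbig_split _ _ _ +%R)//.
by apply: eq_fsbigr => y _; rewrite mulrDr.
Qed.

Lemma convolutionZl (a : K) f g : fiber_finite f ->
  convolution (scale a f) g = scale a (convolution f g).
Proof.
move=> ff; apply/funext => x.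
pose P := [set y | rg y = rg x /\ f y != 0].
have finP : finite_set P by exact: ff.
have Px : P `<=` [set y | rg y = rg x] by move=> y [].
rewrite (@convolutionE _ _ _ P)//.
  rewrite /scale (@convolutionE f _ _ P)// fsbig_distrr//.
  by apply: eq_fsbigr => y _; exact/esym/mulrA.
move=> y [/= yx] afy; split => //.
by apply: contra afy => /eqP fy; rewrite /scale fy mulr0.
Qed.

Lemma convolutionZr (a : K) f g : fiber_finite f ->
  convolution f (scale a g) = scale a (convolution f g).
Proof.
move=> ff; apply/funext => x.
pose P := [set y | rg y = rg x /\ f y != 0].
have finP : finite_set P by exact: ff.
have Px : P `<=` [set y | rg y = rg x] by move=> y [].
rewrite (@convolutionE _ _ _ P)//.
rewrite /scale (@convolutionE f _ _ P)// fsbig_distrr//.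
by apply: eq_fsbigr => y _; exact: mulrCA.
Qed.

Lemma convolution0l g : convolution 0 g = 0.
Proof. by apply/funext => x; apply: fsbig1 => y _; rewrite mul0r. Qed.

Lemma convolution0r f : convolution f 0 = 0.
Proof. by apply/funext => x; apply: fsbig1 => y _; rewrite mulr0. Qed.

Lemma convolution_indic B C : open_bisection B ->
  convolution \1_B \1_C = \1_(setgmul B C) :> (G -> K).
Proof.
move=> bB; apply/funext => x.
have [[b Bb bx]|nB] := pselect (exists2 b, B b & rg b = rg x); last first.
  rewrite indicE memNset/=.
    apply: fsbig1 => y /= yx; rewrite indicE memNset ?mul0r// => By.
    by apply: nB; exists y.
  by move=> [b [c [Bb Cc bc bcx]]]; apply: nB; exists b => //; rewrite -bcx rg_mul.
rewrite (@convolutionE _ _ _ [set b])//; first last.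
- move=> y [yx]; rewrite indicE; have [By _|nBy] := pselect (B y).
    by apply: (open_bisection_inj_rg bB) => //; rewrite yx.
  by rewrite memNset// eqxx.
- by move=> _ ->.
rewrite fsbig_set1 !indicE (mem_set Bb) mul1r; congr (nat_of_bool _)%:R.
apply/idP/idP => /set_mem h; apply/mem_set.
  exists b, (gmul (ginv b) x); split => //; last by rewrite gmulKV.
  by rewrite rg_mul ?rg_inv ?sg_inv.
case: h => b' [c [Bb' Cc bc bcx]].
suff -> : b = b' by rewrite -bcx gmulK.
by apply: (open_bisection_inj_rg bB) => //; rewrite bx -bcx rg_mul.
Qed.

Lemma setgmulA (B C D : set G) :
  setgmul B (setgmul C D) = setgmul (setgmul B C) D.
Proof.
apply/seteqP; split.
  move=> _ [x [_ [Bx [y [z [Cy Dz yz <-]]] + <-]]]; rewrite rg_mul// => xy.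
  exists (gmul x y), z; split => //; first by exists x, y.
    by rewrite sg_mul.
  by rewrite gmulA.
move=> _ [_ [z [[x [y [Bx Cy xy <-]]] Dz + <-]]]; rewrite sg_mul// => yz.
exists x, (gmul y z); split => //; first by exists y, z.
  by rewrite rg_mul.
by rewrite gmulA.
Qed.

Hypothesis ampG : ample G.
Hypothesis hausG : hausdorff_units G.

Lemma steinberg_span_conv f g : span f -> span g -> span (convolution f g).
Proof.
move=> sf sg; elim/steinberg_span_ind: f / sf => [|c B f cobB sf IH].
  by rewrite convolution0l; exact: steinberg_span0.
have s1 := steinberg_span_indic cobB.
rewrite convolutionDl; first last.
- exact: steinberg_span_finite.
- exact/steinberg_span_finite/steinberg_spanZ.
rewrite convolutionZl; last exact: steinberg_span_finite.
apply: steinberg_spanD => //; apply: steinberg_spanZ.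
elim/steinberg_span_ind: g / sg {IH} => [|d C g cobC sg IH].
  by rewrite convolution0r; exact: steinberg_span0.
have ff := steinberg_span_finite s1.
rewrite convolutionDr// convolutionZr// convolution_indic; last exact: cobB.2.
by apply: steinberg_spanD1 => //; exact: compact_open_bisection_mul.
Qed.

Lemma convolutionA f g h : span f -> span g -> span h ->
  convolution f (convolution g h) = convolution (convolution f g) h.
Proof.
have ff k := @steinberg_span_finite k.
have sc k l := @steinberg_span_conv k l.
have sZ a k := @steinberg_spanZ a k.
move=> sf sg sh; elim/steinberg_span_ind: f / sf => [|a B f cobB sf IHf].
  by rewrite !convolution0l.
have sB := steinberg_span_indic cobB.
rewrite !(convolutionDl, convolutionZl); try by auto.
rewrite IHf; congr (scale _ _ + _) => {f sf IHf}.
elim/steinberg_span_ind: g / sg => [|b C g cobC sg IHg].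
  by rewrite !(convolution0l, convolution0r).
have sC := steinberg_span_indic cobC.
rewrite !(convolutionDl, convolutionZl, convolutionDr, convolutionZr);
  try by auto.
rewrite IHg; congr (scale _ _ + _) => {g sg IHg}.
elim/steinberg_span_ind: h / sh => [|d D h cobD sh IHh].
  by rewrite !convolution0r.
rewrite !(convolutionDr, convolutionZr); try by auto.
rewrite IHh; congr (scale _ _ + _) => {h sh IHh}.
have bBC : open_bisection (setgmul B C).
  exact: (compact_open_bisection_mul _ _ cobB cobC).2.
by rewrite !convolution_indic ?setgmulA//; solve [exact: cobB.2|exact: cobC.2].
Qed.

End steinberg_functions_theory.

Section steinberg_algebra.
Context (K : fieldType) (G : topGroupoidType).

Definition steinberg_pred : {pred G -> K^o} := mem (@steinberg_span K G : set (G -> K^o)).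

Lemma steinberg_pred_submod : submod_closed steinberg_pred.
Proof.
split; first by apply/mem_set; exact: steinberg_span0.
move=> a f g /set_mem sf /set_mem sg; apply/mem_set.
by apply: steinberg_spanD => //; exact: steinberg_spanZ.
Qed.

HB.instance Definition _ :=
  GRing.isSubmodClosed.Build K (G -> K^o) steinberg_pred steinberg_pred_submod.

(* The Steinberg algebra of an ample groupoid with Hausdorff unit space; these
   two properties are what makes the span stable under convolution. *)
Record steinberg (ampG : ample G) (hausG : hausdorff_units G) := Steinberg {
  steinberg_val :> G -> K^o;
  steinberg_valP : steinberg_val \in steinberg_pred
}.

Context (ampG : ample G) (hausG : hausdorff_units G).
Local Notation A := (steinberg ampG hausG).

HB.instance Definition _ := [isSub of A for @steinberg_val ampG hausG].
HB.instance Definition _ := [Choice of A by <:].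
HB.instance Definition _ := [SubChoice_isSubLmodule of A by <:].

Lemma steinberg_mul_subproof (f g : A) : convolution f g \in steinberg_pred.
Proof.
apply/mem_set; apply: steinberg_span_conv => //.
- exact: set_mem (steinberg_valP f).
- exact: set_mem (steinberg_valP g).
Qed.

Definition steinberg_mul (f g : A) : A := Steinberg _ _ (steinberg_mul_subproof f g).

Let fin (f : A) : fiber_finite f.
Proof. exact/steinberg_span_finite/set_mem/steinberg_valP. Qed.

Lemma steinberg_mulA : associative steinberg_mul.
Proof.
by move=> f g h; apply/val_inj/convolutionA => //; exact/set_mem/steinberg_valP.
Qed.

Lemma steinberg_mulDl : left_distributive steinberg_mul +%R.
Proof. by move=> f g h; apply/val_inj/convolutionDl; exact: fin. Qed.

Lemma steinberg_mulDr : right_distributive steinberg_mul +%R.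
Proof. by move=> f g h; apply/val_inj/convolutionDr; exact: fin. Qed.

Lemma steinberg_mulZl (a : K) f g :
  steinberg_mul (a *: f) g = a *: steinberg_mul f g.
Proof. by apply/val_inj/convolutionZl; exact: fin. Qed.

Lemma steinberg_mulZr (a : K) f g :
  steinberg_mul f (a *: g) = a *: steinberg_mul f g.
Proof. by apply/val_inj/convolutionZr; exact: fin. Qed.

HB.instance Definition _ := Lmodule_isNUAlgebra.Build K A
  steinberg_mulA steinberg_mulDl steinberg_mulDr steinberg_mulZl steinberg_mulZr.

End steinberg_algebra.

(* Main.v *)
(* Effectiveness lets one shrink any nonempty open set of units to one, W, for
   which a given bisection B either contains W or has no arrow with both ends
   in W. Applied to the finitely many bisections in the expression of an
   element of the Steinberg algebra, this yields W on which its corner is a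
   multiple of the characteristic function of W; no Baire category argument is
   needed. Given f in the kernel, supp(f) contains the inverse of a bisection
   C; then 1_C * f does not vanish on r(C), and cutting it down to some L inside
   r(C) gives a nonzero multiple of 1_L. *)
Require Import Defs.
From HB Require Import structures.
From mathcomp Require Import all_boot all_order all_algebra.
From mathcomp Require Import mathcomp_extra boolp classical_sets functions.
From mathcomp Require Import cardinality fsbigop topology numfun.

Set Implicit Arguments.
Unset Strict Implicit.
Unset Printing Implicit Defensive.

Import GRing.Theory.

Local Open Scope classical_set_scope.
Local Open Scope ring_scope.

Lemma ginvK (G : groupoidType) : involutive (@ginv G).
Proof.
move=> x; rewrite -[LHS]sg_mul1 sg_inv rg_inv -gmulVl gmulA ?sg_inv ?rg_inv//.
by rewrite gmulVl sg_inv rg_mul1.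
Qed.

Section effective_ample.
Context {K : fieldType} {G : topGroupoidType}.
Hypothesis ampG : ample G.
Hypothesis hausG : hausdorff_units G.
Implicit Types (B C L W : set G) (x y : G) (f g : G -> K).

(** Contrapositive of [hausdorff_unitsP]: if all neighbourhoods in [G] met, the two units would
    coincide. *)
Lemma separate_units x y : units G x -> units G y -> x != y ->
  exists U V : set G, [/\ open_nbhs x U, open_nbhs y V & U `&` V = set0].
Proof.
move=> Gx Gy xy; apply: contrapT => nUV; move/eqP: xy; apply.
apply: (hausdorff_unitsP ampG hausG) => // A B xA yB.
apply/set0P/negP => /eqP AB0; apply: nUV.
exists A°, B°; split.
- by split; [exact: open_interior|exact: xA].
- by split; [exact: open_interior|exact: yB].
- by rewrite -subset0 => z [/interior_subset Az /interior_subset Bz]; rewrite -AB0.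
Qed.

Lemma shrink_units_bisection B W : effective G -> open_bisection B ->
  open W -> W `<=` units G -> W !=set0 ->
  exists W', [/\ open W', W' `<=` W, W' !=set0 &
    W' `<=` B \/ forall x, B x -> W' (rg x) -> W' (sg x) -> False].
Proof.
move=> effG bB oW WG W0; have [oB _ sB] := bB.
have [[x [Bx Wx xx]]|niso] :=
    pselect (exists x, [/\ B x, W (sg x) & rg x != sg x]).
  have [U [V [[oU Ux] [oV Vx] UV0]]] :=
    separate_units (units_rg x) (units_sg x) xx.
  have [osB [h hK hc]] := homeo_openP ampG sB.
  (* Since [sg] is injective on [B], an arrow of [B] with source in this set has its range in [U],
     hence outside [V]. *)
  exists (W `&` V `&` sg @` (B `&` rg @^-1` U)); split.
  - apply: openI; first exact: openI.
    apply: open_local_homeo hK osB hc.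
    by apply: open_comp oU => ? _; exact: rg_continuous.
  - by move=> ? [[]].
  - by exists (sg x); split => //; exists x.
  - right=> y By [[_ Vy] _] [_ [b [Bb Ub]]].
    move=> /(open_bisection_inj_sg bB Bb By) b_y.
    by rewrite -[False]/(set0 (rg y)) -UV0; split; rewrite // -b_y.
(* Now every arrow of [B] with source in [W] is isotropic, so by effectiveness the open set [I]
   consists of units. It is the set sought unless empty, in which case [W] itself will do. *)
pose I := B `&` sg @^-1` W.
have oI : open I.
  by apply: openI => //; apply: open_comp oW => ? _; exact: sg_continuous.
have IG : I `<=` units G.
  rewrite -effG -open_subsetE// => x [Bx Wx] /=.
  by apply: contrapT => /eqP xx; apply: niso; exists x.
have [[y [By Wy]]|I0] := pselect (I !=set0).
  have IW : I `<=` W by move=> x Ix; rewrite -(sg_unit (IG _ Ix)); case: Ix.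
  by exists I; split => //; [exists y|left=> x []].
exists W; split => //; right=> x Bx _ Wx.
by apply: I0; exists x.
Qed.

(** Induction on the terms of [f], shrinking once per bisection: a term with coefficient [a] either
    adds [a] to the constant or vanishes on all arrows with both ends in the new set. *)
Lemma shrink_units_span f W : effective G -> steinberg_span f ->
  open W -> W `<=` units G -> W !=set0 ->
  exists W' (c : K), [/\ open W', W' `<=` W, W' !=set0 &
    forall x, W' (rg x) -> W' (sg x) -> f x = c * \1_(units G) x].
Proof.
move=> effG sf; move: W; elim/(@steinberg_span_ind K G): f / sf => [|a B f [_ bB] _ IH] W.
  by move=> oW _ W0; exists W, 0; split => // x _ _; rewrite mul0r.
move=> oW WG W0.
have [W1 [c [oW1 W1W W10 fc]]] := IH W oW WG W0.
have W1G := subset_trans W1W WG.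
have [W2 [oW2 W21 W20 W2B]] := shrink_units_bisection effG bB oW1 W1G W10.
exists W2.
case: W2B => [W2B|W2B].
  exists (a + c); split => //; first exact: subset_trans W1W.
  move=> x rx sx; rewrite fctE (fc x) ?mulrDl; [|exact: W21|exact: W21].
  congr (a * _ + _); rewrite !indicE; congr (nat_of_bool _)%:R.
  (* As [W2] lies in [B] and [sg] is injective on [B], an arrow of [B] with source in [W2] equals
     that source. *)
  apply/idP/idP => /set_mem xB; apply/mem_set.
    rewrite (open_bisection_inj_sg bB xB (W2B _ sx)) ?sg_sg//.
    exact: units_sg.
  by rewrite -(sg_unit xB); exact: W2B.
exists c; split => //; first exact: subset_trans W1W.
move=> x rx sx; rewrite fctE (fc x); [|exact: W21|exact: W21].
by rewrite indicE memNset ?mulr0 ?add0r// => Bx; exact: W2B sx.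
Qed.

(** The bisection [C] has a single arrow with range [rg x], so one term remains. *)
Lemma convolution_indicl C f x y : open_bisection C -> C y -> rg y = rg x ->
  convolution \1_C f x = f (gmul (ginv y) x).
Proof.
move=> bC Cy yx; rewrite (@convolutionE _ _ _ _ _ [set y])//.
- by rewrite fsbig_set1 indicE (mem_set Cy) mul1r.
- by move=> _ ->.
- move=> z [zx]; rewrite indicE; have [Cz _|nCz] := pselect (C z).
    by apply: (open_bisection_inj_rg bC) => //; rewrite zx.
  by rewrite memNset// eqxx.
Qed.

Lemma convolution_unitsl L f x : L `<=` units G ->
  convolution \1_L f x = \1_L (rg x) * f x.
Proof.
move=> LG; rewrite /convolution -(@fsbig_widen _ _ _ _ [set rg x]).
- by rewrite fsbig_set1 -{3}(rg_mul1 x) gmulK ?sg_rg.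
- by move=> _ ->; exact: rg_rg.
- move=> y [/= yx xy]; rewrite indicE memNset ?mul0r// => Ly.
  by apply: xy; rewrite -yx rg_unit//; exact: LG.
Qed.

(** A term survives only if [gmul (ginv y) x] is a unit, which forces [y = x]. *)
Lemma convolution_unitsr L f x : L `<=` units G ->
  convolution f \1_L x = f x * \1_L (sg x).
Proof.
move=> LG; rewrite /convolution -(@fsbig_widen _ _ _ _ [set x]).
- by rewrite fsbig_set1 gmulVl.
- by move=> _ ->.
- move=> y [/= yx xy]; rewrite indicE memNset ?mulr0// => /LG Ly.
  apply: xy; rewrite -[RHS](gmulKV yx) -(rg_unit Ly).
  by rewrite rg_mul ?sg_inv// rg_inv sg_mul1.
Qed.

End effective_ample.

Lemma numul0r (K : fieldType) (A : nuAlgType K) (a : A) : numul a 0 = 0.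
Proof. by rewrite -[X in numul a X](scale0r a) numulZr scale0r. Qed.

Lemma numul0l (K : fieldType) (A : nuAlgType K) (a : A) : numul 0 a = 0.
Proof. by rewrite -[X in numul X a](scale0r a) numulZl scale0r. Qed.

Theorem theorem3p11 (K : fieldType) (G : topGroupoidType)
    (scG : @second_countable G) (ampG : ample G) (hausG : hausdorff_units G)
    (effG : effective G)
    (suppG : forall f : steinberg K ampG hausG, f != 0 -> (supp f)° !=set0)
    (A : nuAlgType K) (pi : {additive steinberg K ampG hausG -> A})
    (piM : {morph pi : f g / numul f g >-> numul f g})
    (kerpi : exists2 f : steinberg K ampG hausG, f != 0 & pi f = 0) :
  exists L : set G,
    [/\ L !=set0, L `<=` units G, compact L, open L
      & exists2 f : steinberg K ampG hausG,
          (f : G -> K) = \1_L & pi f = 0].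
Proof.
case: kerpi => f f0 pif.
have [z zf] := suppG _ f0.
have /(ample_nbhs ampG)[C [cobC Cz Cf]] : nbhs (ginv z) (ginv @^-1` (supp f)°).
  apply: ginv_continuous; rewrite ginvK; apply: open_nbhs_nbhs.
  by split => //; exact: open_interior.
pose indic B (cobB : compact_open_bisection B) : steinberg K ampG hausG :=
  @Steinberg K G ampG hausG \1_B (mem_set (@steinberg_span_indic K G B cobB)).
pose g := numul (indic C cobC) f.
have [_ [_ rC _]] := cobC.
have [orC _] := homeo_openP ampG rC.
have rCG : rg @` C `<=` units G by move=> _ [x _ <-]; exact: units_rg.
have rC0 : rg @` C !=set0 by exists (rg (ginv z)), (ginv z).
have [W [c [oW WC [u Wu] gc]]] :=
  shrink_units_span ampG hausG effG (set_mem (steinberg_valP g)) orC rCG rC0.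
(* Writing [u = rg y] with [y] in [C] gives [c = g u = f (ginv y)], and [ginv y] lies in [supp f] by
   the choice of [C]. *)
have c0 : c != 0.
  have [y Cy yu] := WC _ Wu.
  have Gu := rCG _ (WC _ Wu).
  have := gc u; rewrite rg_unit// sg_unit// => /(_ Wu Wu).
  rewrite /= (@convolution_indicl _ _ C f u y cobC.2)// -?yu ?rg_rg//.
  rewrite -(sg_inv y) sg_mul1 => fy.
  have /interior_subset := Cf _ Cy.
  by rewrite /supp /= fy; apply: contraNneq => ->; rewrite mul0r.
have /(ample_nbhs ampG)[L [cobL Lu LW]] : nbhs u W by exact: open_nbhs_nbhs.
have LG : L `<=` units G by move=> x /LW/WC/rCG.
exists L; split => //; [by exists u|exact: cobL.1|by case: cobL.2|].
pose l := indic L cobL.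
(* [pi] is additive and multiplicative but need not be linear, so [c^-1] is attached to the factor
   [l] instead of being pulled out of [pi]. *)
exists (numul (numul (c^-1 *: l) g) l); last first.
  by rewrite !piM pif numul0r numul0r numul0l.
rewrite !numulZl; apply/funext => x.
rewrite -[LHS]/(c^-1 * convolution (convolution \1_L g) \1_L x).
rewrite convolution_unitsr// convolution_unitsl//.
have [Lr|nLr] := pselect (L (rg x)); last first.
  rewrite !indicE (memNset nLr) !mul0r mulr0 memNset// => Lx.
  by apply: nLr; rewrite rg_unit//; exact: LG.
have [Ls|nLs] := pselect (L (sg x)); last first.
  rewrite !indicE (memNset nLs) !mulr0 memNset// => Lx.
  by apply: nLs; rewrite sg_unit//; exact: LG.
rewrite !indicE (mem_set Lr) (mem_set Ls) mul1r mulr1.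
rewrite gc; [|exact: LW|exact: LW].
rewrite mulKf// indicE; congr (nat_of_bool _)%:R.
(* A unit equals its own range, here a point of [L]. *)
apply/idP/idP => /set_mem h; apply/mem_set; last exact: LG.
by rewrite -(rg_unit h).
Qed.
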